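(* Let $G$ be a graph of order $n\ge 2$ with $\gamma_2(G)\ge 2$ and $\gamma_2(\overline{G})\ge 2$, where $\overline{G}$ is the complement of $G$. Then $st_{\gamma_2}(G)+st_{\gamma_2}(\overline{G})\le 2n-2$.
   Context: All graphs are finite, simple and undirected. For a graph $G=(V,E)$, a subset $D \subseteq V$ is a 2-dominating set if every vertex $v \in V \setminus D$ has at least two neighbors in $D$. The 2-domination number $\gamma_2(G)$ is the minimum cardinality of a 2-dominating set of $G$. The stability of the 2-domination number, $st_{\gamma_2}(G)$, is the minimum number of vertices whose removal from $G$ (deleting the vertices and all incident edges) changes the 2-domination number, i.e. the minimum of $|S|$ over $S\subseteq V$ with $\gamma_2(G-S)\ne\gamma_2(G)$. *)

(* Defs.v *)
From mathcomp Require Import all_boot.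

Set Implicit Arguments.
Unset Strict Implicit.
Unset Printing Implicit Defensive.

Record sgraph := SGraph {
  vertex :> finType;
  adj : rel vertex;
  adj_sym : symmetric adj;
  adj_irrefl : irreflexive adj
}.

Section Constructions.
Variable G : sgraph.

Definition compl_adj : rel G := fun x y => (x != y) && ~~ adj x y.

Lemma compl_adj_sym : symmetric compl_adj.
Proof. by move=> x y; rewrite /compl_adj eq_sym adj_sym. Qed.

Lemma compl_adj_irrefl : irreflexive compl_adj.
Proof. by move=> x; rewrite /compl_adj eqxx. Qed.

Definition complement : sgraph := SGraph compl_adj_sym compl_adj_irrefl.

Variable S : {set G}.

Definition del_adj : rel {x : G | x \notin S} := fun x y => adj (val x) (val y).

Lemma del_adj_sym : symmetric del_adj.
Proof. by move=> x y; rewrite /del_adj adj_sym. Qed.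

Lemma del_adj_irrefl : irreflexive del_adj.
Proof. by move=> x; rewrite /del_adj adj_irrefl. Qed.

Definition del_vertices : sgraph := SGraph del_adj_sym del_adj_irrefl.

End Constructions.

Definition two_dominating (G : sgraph) (D : {set G}) : bool :=
  [forall v in ~: D, 2 <= #|[set u in D | adj v u]|].

Lemma two_dominating_setT (G : sgraph) : two_dominating [set: G].
Proof. by apply/forall_inP => v; rewrite setCT inE. Qed.

(* [set: G] is always admissible here, so this is a genuine minimum. *)
Definition gamma2 (G : sgraph) : nat :=
  #|[arg min_(D < [set: G] | two_dominating D) #|D|]|.

(* S ranges over all vertex sets, so G - S may be the null graph, with gamma2
   equal to 0. By [gamma2_del_setT], [set: G] is admissible as soon as G has a
   vertex, and this is then a genuine minimum; on the null graph, where no S is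
   admissible, the value is 0. *)
Definition st_gamma2 (G : sgraph) : nat :=
  #|[arg min_(S < [set: G] | gamma2 (del_vertices S) != gamma2 G) #|S|]|.

Lemma gamma2_gt0 (G : sgraph) : 0 < #|G| -> 0 < gamma2 G.
Proof.
case/card_gt0P => v _; rewrite /gamma2.
case: arg_minnP => [|D domD _]; first exact: two_dominating_setT.
rewrite card_gt0; apply/eqP => D0; move/forall_inP: domD => /(_ v).
rewrite D0 setC0 inE => /(_ isT); rewrite (_ : [set _ in _ | _] = set0) ?cards0 //.
by apply/setP => u; rewrite !inE.
Qed.

Lemma gamma2_del_setT (G : sgraph) :
  0 < #|G| -> gamma2 (del_vertices [set: G]) != gamma2 G.
Proof.
move=> /gamma2_gt0; rewrite lt0n eq_sym; congr (_ != _); apply/esym/eqP.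
rewrite -leqn0 (leq_trans (max_card _)) // leqn0; apply/eqP.
by apply: eq_card0 => -[x xS]; exfalso; rewrite inE in xS.
Qed.

(* Main.v *)
(** A graph with a single vertex has 2-domination number at most 1, so deleting
    all vertices but one changes a 2-domination number that is at least 2. *)
Require Import Defs.
From mathcomp Require Import all_boot.

(** The bound splits: by [st_gamma2_le_card_pred], each of the two stabilities is at most n - 1,
    since [G] and its complement have the same order n. *)

Lemma gamma2_le_card (G : sgraph) : gamma2 G <= #|G|.
Proof. exact: max_card. Qed.

Lemma card_del_vertices (G : sgraph) (S : {set G}) :
  #|del_vertices S| = #|G| - #|S|.
Proof.
rewrite card_sig -[in RHS](setCK S) -cardsCs.
by apply: eq_card => x; rewrite !inE.
Qed.

Lemma st_gamma2_le_card_pred (G : sgraph) :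
  2 <= gamma2 G -> st_gamma2 G <= #|G|.-1.
Proof.
move=> gamma_ge2.
have G_gt0 : 0 < #|G| by apply: leq_trans (gamma2_le_card G); apply: ltnW.
have [v _] := card_gt0P G_gt0.
rewrite /st_gamma2; case: arg_minnP => [|S _ minS]; first exact: gamma2_del_setT.
(* The witness is the complement of [[set v]], which leaves only [v]. *)
rewrite -(cardsC1 v); apply: minS.
(* The value strictly drops: it is at most the remaining order, 1. *)
rewrite neq_ltn (leq_ltn_trans (gamma2_le_card _)) //.
by rewrite card_del_vertices cardsC1 -subn1 subKn.
Qed.

Theorem theorem3p7 (G : sgraph) (n : nat)
  (order_G : #|G| = n) (n_ge2 : 2 <= n)
  (gamma2_G : 2 <= gamma2 G) (gamma2_coG : 2 <= gamma2 (complement G)) :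
  st_gamma2 G + st_gamma2 (complement G) <= 2 * n - 2.
Proof.
rewrite -{2}[2]muln1 -mulnBr subn1 mul2n -addnn -order_G.
(* [complement G] has vertex type [G] by conversion, so both bounds read [#|G|.-1]. *)
exact: leq_add (st_gamma2_le_card_pred _ gamma2_G)
               (st_gamma2_le_card_pred _ gamma2_coG).
Qed.
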